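(* There is an absolute constant $C>0$ with the following property. Let a group $\Gamma$ act freely on sets $X$ and $Y$, and suppose that the column orbit space $Y/\Gamma$ is finite. Let $K:X\times Y\to\mathbb{Z}$ be diagonally $\Gamma$-invariant, meaning $K(gx,gy)=K(x,y)$ for all $g\in\Gamma$, $x\in X$, $y\in Y$, and suppose $K$ has an equivariant $\gamma$-factorization. Then $$K=\sum_{i=1}^{L}\sigma_i B_i,\qquad L\le 2^{C\gamma^4},$$ where each $\sigma_i\in\{-1,1\}$ and each $B_i$ is a $\Gamma$-equivariant equality kernel.
   Context: Equality kernel: a kernel $B:X\times Y\to\{0,1\}$ is an equality kernel if there exist a set $\Lambda$ (the label set), a dummy symbol $\bot\notin\Lambda$, and maps $\phi:X\to\Lambda\cup\{\bot\}$, $\psi:Y\to\Lambda\cup\{\bot\}$ such that for all $x\in X$, $y\in Y$: $B(x,y)=1\iff \phi(x)=\psi(y)\in\Lambda$. If a group $\Gamma$ acts on $X$ and on $Y$, $B$ is $\Gamma$-equivariant if $B(gx,gy)=B(x,y)$ for every $g\in\Gamma$, $x\in X$, $y\in Y$. Equivariant $\gamma$-factorization: for a group $\Gamma$ acting on $X$ and $Y$, an equivariant $\gamma$-factorization of a kernel $A:X\times Y\to\mathbb{R}$ consists of a real Hilbert space $\mathcal H$, an orthogonal representation $R:\Gamma\to O(\mathcal H)$, and vectors $u_x,v_y\in\mathcal H$ ($x\in X$, $y\in Y$) such that $A(x,y)=\langle u_x,v_y\rangle$, $\|u_x\|\le 1$, $\|v_y\|\le\gamma$ for all $x,y$, and $u_{gx}=R_gu_x$,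 $v_{gy}=R_gv_y$ for all $g\in\Gamma$. *)

(* Defs.v *)
From HB Require Import structures.
From mathcomp Require Import all_boot all_order all_algebra all_fingroup.
From mathcomp Require Import all_classical all_reals all_analysis.

Set Implicit Arguments.
Unset Strict Implicit.
Unset Printing Implicit Defensive.

Import Order.TTheory GRing.Theory Num.Theory.
Import numFieldNormedType.Exports.

Local Open Scope classical_set_scope.
Local Open Scope ring_scope.

(* [groupType] covers arbitrary, possibly infinite, groups; MathComp's
   [action] structure is restricted to finite groups, hence the definitions of
   (left) actions below. *)
Record is_left_action (G : groupType) (X : Type) (act : G -> X -> X) : Prop := {
  left_act1 : forall x, act 1%g x = x;
  left_actM : forall g h x, act (g * h)%g x = act g (act h x) }.

Definition free_action (G : groupType) (X : Type) (act : G -> X -> X) : Prop :=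
  is_left_action act /\ forall g x, act g x = x -> g = 1%g.

Definition orbit_space (G : groupType) (X : Type) (act : G -> X -> X) :
    set (set X) :=
  range (fun x => range (act ^~ x)).

Definition invariant_kernel (G : groupType) (X Y T : Type)
    (actX : G -> X -> X) (actY : G -> Y -> Y) (A : X -> Y -> T) : Prop :=
  forall g x y, A (actX g x) (actY g y) = A x y.

(* The dummy symbol is [None : option Lam]. *)
Definition equality_kernel (X Y : Type) (B : X -> Y -> bool) : Prop :=
  exists (Lam : Type) (phi : X -> option Lam) (psi : Y -> option Lam),
    forall x y, B x y <-> exists l : Lam, phi x = Some l /\ psi y = Some l.

Record hilbertSpace (R : realType) := HilbertSpace {
  hilbert_sort :> completeNormedModType R;
  hdot : {dot hilbert_sort for idfun};
  hdot_norm : forall x : hilbert_sort, hdot x x = `|x| ^+ 2 }.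

Definition orthogonal_map (R : realType) (H : hilbertSpace R)
    (T : {linear H -> H}) : Prop :=
  bijective T /\ forall x y : H, hdot H (T x) (T y) = hdot H x y.

(* As every [rho g] is bijective, multiplicativity forces [rho 1 = id]. *)
Definition orthogonal_representation (R : realType) (G : groupType)
    (H : hilbertSpace R) (rho : G -> {linear H -> H}) : Prop :=
  (forall g, orthogonal_map (rho g)) /\
  (forall g h x, rho (g * h)%g x = rho g (rho h x)).

Definition equivariant_factorization (R : realType) (G : groupType)
    (X Y : Type) (actX : G -> X -> X) (actY : G -> Y -> Y)
    (gamma : R) (A : X -> Y -> R) : Prop :=
  exists (H : hilbertSpace R) (rho : G -> {linear H -> H})
         (u : X -> H) (v : Y -> H),
    [/\ orthogonal_representation rho,
        forall x y, A x y = hdot H (u x) (v y),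
        (forall x, `|u x| <= 1) /\ (forall y, `|v y| <= gamma),
        forall g x, u (actX g x) = rho g (u x) &
        forall g y, v (actY g y) = rho g (v y)].

(* Main.v *)
(* Write u_x, v_y for the vectors of the factorization. Columns are decomposed
   into integer columns f which are well approximated by a vector c, that is,
   <u_x, c> is close to f(x) for every x. If c and a nonzero proper "limit" p of
   such vectors satisfy <p, c - p> >= -1/8, then c splits as p + (c - p) with
   almost no loss of energy; every nonzero piece has squared norm at least 3/4,
   so a column splits into at most 2 gamma^2 pieces. Take decompositions with a
   maximal number of pieces. If more than 2^(C gamma^4) distinct pieces of
   maximal decompositions were positive at one row x, a large subfamily would
   have, at every row and every integer threshold, almost all values on one
   side: otherwise pass to the side with the larger least squared norm on its
   hull, which goes up by 1/8 because the sides are separated by integrality.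
   The mean p of that subfamily is then nearly integer at every row and nonzero
   at x, and splits a piece further: contradiction. So every row meets boundedly
   many pieces of each sign, and enumerating these gives the equality kernels. *)
Require Import Defs.
From HB Require Import structures.
From mathcomp Require Import all_boot all_order all_algebra all_fingroup.
From mathcomp Require Import all_classical all_reals all_analysis.
From mathcomp Require Import zify ring lra.

Set Implicit Arguments.
Unset Strict Implicit.
Unset Printing Implicit Defensive.

Import Order.TTheory GRing.Theory Num.Theory.
Import numFieldNormedType.Exports.

Local Open Scope classical_set_scope.
Local Open Scope ring_scope.

(** * Inner product inequalities *)

Lemma hdotC (R : realType) (H : hilbertSpace R) (a b : H) :
  hdot H a b = hdot H b a.
Proof. by rewrite hermC /= expr0 mul1r. Qed.

Lemma hdot_ge0 (R : realType) (H : hilbertSpace R) (a : H) : 0 <= hdot H a a.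
Proof. by rewrite hdot_norm exprn_ge0. Qed.

Lemma hdotBB (R : realType) (H : hilbertSpace R) (a b : H) :
  hdot H (a - b) (a - b) = hdot H a a - 2 * hdot H a b + hdot H b b.
Proof. rewrite linearBl /= !linearBr /= (hdotC b a); ring. Qed.

Lemma hdotZr (R : realType) (H : hilbertSpace R) (t : R) (a b : H) :
  hdot H a (t *: b) = t * hdot H a b.
Proof. by rewrite linearZr_LR. Qed.

Lemma hdotZl (R : realType) (H : hilbertSpace R) (t : R) (a b : H) :
  hdot H (t *: a) b = t * hdot H a b.
Proof. by rewrite hdotC hdotZr hdotC. Qed.

(** Cauchy-Schwarz, from the nonnegative squared norm of [hdot H u p *: u - p]. *)
Lemma hdot_unit_sqr_le (R : realType) (H : hilbertSpace R) (u p : H) :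
  `|u| <= 1 -> hdot H u p ^+ 2 <= hdot H p p.
Proof.
move=> u1; have uu1 : hdot H u u <= 1 by rewrite hdot_norm expr_le1.
have := hdot_ge0 (hdot H u p *: u - p).
rewrite hdotBB !hdotZl hdotZr.
set t := hdot H u p; set q := hdot H u u in uu1 *; rewrite -/t.
have tq : t * (t * q) <= t * t.
  by rewrite mulrA ler_piMr // -expr2 sqr_ge0.
by move: tq; rewrite expr2; lra.
Qed.

(** * Midpoint hulls and large subfamilies without balanced cuts *)

Definition mean (R : realType) (V : lmodType R) (I : finType) (S : {set I})
  (c : I -> V) : V := #|S|%:R^-1 *: \sum_(i in S) c i.

Lemma sum_hdot_mean (R : realType) (H : hilbertSpace R) (I : finType)
    (S : {set I}) (c : I -> H) (p := mean S c) : (0 < #|S|)%N ->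
  \sum_(i in S) hdot H p (c i - p) = 0.
Proof.
move=> S0; rewrite -linear_sumr /= sumrB sumr_const.
suff -> : \sum_(i in S) c i = #|S|%:R *: p by rewrite scaler_nat subrr linear0r.
by rewrite scalerA divff ?scale1r // pnatr_eq0 -lt0n.
Qed.

(** Closure under midpoints replaces the convex hull: the parallelogram argument for cuts uses
    midpoints only, and linear bounds pass to them by induction. *)
Inductive midhull (R : realType) (V : lmodType R) (I : finType) (S : {set I})
    (c : I -> V) : V -> Prop :=
| midhull_gen i : i \in S -> midhull S c (c i)
| midhull_mid p q : midhull S c p -> midhull S c q ->
    midhull S c (2^-1 *: (p + q)).

(** Energy is counted in steps of [1 / 8], so that progress along cuts is a natural number. *)
Definition hull_energy (R : realType) (H : hilbertSpace R) (I : finType)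
    (c : I -> H) (n : nat) (S : {set I}) : Prop :=
  forall p, midhull S c p -> n%:R / 8 <= hdot H p p.

Lemma midhull_sub (R : realType) (V : lmodType R) (I : finType) (S T : {set I})
  (c : I -> V) p : S \subset T -> midhull S c p -> midhull T c p.
Proof.
move=> /fintype.subsetP ST; elim=> [i /ST|q r _ ? _ ?]; first exact: midhull_gen.
exact: midhull_mid.
Qed.

Lemma midhull_hdot_le (R : realType) (H : hilbertSpace R) (I : finType)
    (S : {set I}) (c : I -> H) (u : H) (b : R) p :
  (forall i, i \in S -> hdot H u (c i) <= b) -> midhull S c p ->
  hdot H u p <= b.
Proof.
move=> Sb; elim=> [i /Sb //|q r _ hq _ hr].
rewrite hdotZr linearDr /=; lra.
Qed.

(* The midpoint of two hull points separated by [3/4] in the direction [u] has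
   energy at least [9/64 > 1/8] below the larger of the two. *)
Lemma hull_energy_split (R : realType) (H : hilbertSpace R) (I : finType)
    (c : I -> H) (n : nat) (S S1 S2 : {set I}) (u : H) (b : R) : `|u| <= 1 ->
  S1 \subset S -> S2 \subset S ->
  (forall i, i \in S1 -> hdot H u (c i) <= b) ->
  (forall i, i \in S2 -> b + 3 / 4 <= hdot H u (c i)) ->
  hull_energy c n S -> hull_energy c n.+1 S1 \/ hull_energy c n.+1 S2.
Proof.
move=> u1 S1S S2S h1 h2 hS.
have [|/asboolPn] := pselect (hull_energy c n.+1 S1); first by left.
move=> /existsp_asboolPn [p /not_implyP[Sp /negP]]; rewrite -ltNge => pn.
right=> q Sq; rewrite leNgt; apply/negP => qn.
have pb : hdot H u p <= b by apply: midhull_hdot_le Sp.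
have qb : b + 3 / 4 <= hdot H u q.
  rewrite -lerN2 -linearNl /=.
  by apply: midhull_hdot_le Sq => i /h2; rewrite linearNl lerN2.
have := hS _ (midhull_mid (midhull_sub S1S Sp) (midhull_sub S2S Sq)).
have := hdot_unit_sqr_le (q - p) u1; rewrite hdotBB.
rewrite hdotZr hdotZl !linearDr /= linearNr /=.
rewrite !linearDl /= (hdotC p q).
have : (3 / 4) ^+ 2 <= (hdot H u q - hdot H u p) ^+ 2.
  by rewrite ler_sqr ?nnegrE; lra.
move: pn qn; rewrite -natr1; set x := hdot H u _ - _; set y := x ^+ 2.
rewrite expr2; lra.
Qed.

Definition cut_good (X : Type) (I : finType) (f : I -> X -> int) (P : nat)
    (S : {set I}) : Prop :=
  forall x a, (P * #|[set i in S | (f i x <= a)%R]| <= #|S|)%N \/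
              (P * #|[set i in S | (a < f i x)%R]| <= #|S|)%N.

(* Along a cut that is not balanced to within a factor [P], one side gains one
   unit of hull energy at the cost of a factor [P] in size; the energy is at
   most [8 * D], so this stops. *)
Lemma cut_good_subset (R : realType) (H : hilbertSpace R) (X : Type)
    (u : X -> H) (I : finType) (c : I -> H) (f : I -> X -> int) (D P Q : nat) :
  (forall x, `|u x| <= 1) -> (0 < P)%N -> (0 < Q)%N ->
  (forall i x, `|hdot H (u x) (c i) - (f i x)%:~R| <= 1 / 8) ->
  (forall i, hdot H (c i) (c i) <= D%:R) ->
  forall k n S, hull_energy c n S -> (8 * D < n + k)%N ->
  (Q * P ^ k <= #|S|)%N -> exists2 T : {set I}, cut_good f P T & (Q <= #|T|)%N.
Proof.
move=> u1 P0 Q0 fE cD; elim=> [|k IH] n S hS nk Sk.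
  have /card_gt0P[i iS] : (0 < #|S|)%N by rewrite (leq_trans _ Sk) ?muln_gt0 ?Q0.
  have := le_trans (hS _ (midhull_gen c iS)) (cD i).
  rewrite ler_pdivrMr// -natrM ler_nat; lia.
have [gS|/asboolPn] := pselect (cut_good f P S).
  exists S => //; rewrite (leq_trans _ Sk)// leq_pmulr// expn_gt0 P0//.
move=> /existsp_asboolPn [x /asboolPn /existsp_asboolPn [a]].
move=> /not_orP[/negP ha /negP hb]; rewrite -!ltnNge in ha hb.
have small (A : {set I}) : (#|S| < P * #|A|)%N -> (Q * P ^ k <= #|A|)%N.
  move=> SA; rewrite -(leq_pmul2l P0) mulnCA -expnS.
  exact: leq_trans Sk (ltnW SA).
(* With errors at most [1 / 8], the values [f <= a] and [f >= a + 1] give inner products at most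
   [a + 1 / 8] and at least [a + 7 / 8]: a gap of [3 / 4]. *)
have := @hull_energy_split R H I c n S [set i in S | f i x <= a]
  [set i in S | a < f i x] (u x) (a%:~R + 1 / 8) (u1 x).
have sub (p : pred I) : [set i in S | p i] \subset S.
  by apply/fintype.subsetP => i; rewrite inE => /andP[].
case=> //.
- move=> i; rewrite inE => /andP[_]; rewrite -(ler_int R).
  have := fE i x; rewrite ler_norml => /andP[_]; lra.
- move=> i; rewrite inE => /andP[_]; rewrite -lezD1 -(ler_int R) intrD.
  have := fE i x; rewrite ler_norml => /andP[+ _]; lra.
- by move=> h; apply: (IH _ _ h); [lia | apply: small].
- by move=> h; apply: (IH _ _ h); [lia | apply: small].
Qed.

(** * Nearly integer means and limits that split a piece *)

(** The sums are the positive and negative parts of [z], cut into unit layers. Values thereby reduce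
    to threshold cuts, and integer entries to signed 0/1 entries. *)
Lemma int_layer_cake (z : int) (B : nat) : `|z| <= B%:Z ->
  z = \sum_(t < B) (t%:Z < z)%R%:Z - \sum_(t < B) (t%:Z < - z)%R%:Z.
Proof.
have pos (n : nat) (w : int) : \sum_(t < n) (t%:Z < w)%R%:Z =
    if 0 <= w then (if w <= n%:Z then w else n%:Z) else 0.
  elim: n => [|n IH]; first by rewrite big_ord0; case: ifP => //; case: ifP; lia.
  rewrite big_ord_recr /= IH; case: (ltP n%:Z w) => h /=;
  by do ![case: ifP => ?]; lia.
move=> zB; rewrite !pos; do ![case: ifP => ?]; lia.
Qed.

(** Each of the [2 * B] layers has an indicator sum within [#|S| / P] of [0] or of [#|S|]; adding
    the layers puts the whole sum near an integer multiple of [#|S|]. *)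
Lemma cut_good_sum (X : Type) (I : finType) (f : I -> X -> int) (P B : nat)
    (S : {set I}) (x : X) : cut_good f P S -> (forall i, `|f i x| <= B%:Z) ->
  exists z : int,
    P%:Z * `|\sum_(i in S) f i x - z * #|S|%:Z| <= (2 * B * #|S|)%:Z.
Proof.
move=> gS fB.
have near (A A' : {set I}) : (#|A| + #|A'| = #|S|)%N ->
    (P * #|A| <= #|S|)%N \/ (P * #|A'| <= #|S|)%N ->
    exists e : int, P%:Z * `|#|A|%:Z - e * #|S|%:Z| <= #|S|%:Z.
  move=> AA [h|h]; [exists 0 | exists 1]; first by rewrite mul0r subr0; lia.
  by rewrite mul1r (_ : `| _ | = #|A'|%:Z); lia.
have cardC a : (#|[set i in S | (a < f i x)%R]| +
    #|[set i in S | (f i x <= a)%R]|)%N = #|S|.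
  rewrite -(cardsID [set i | a < f i x] S); congr (_ + _)%N.
    by apply: eq_card => i; rewrite !inE.
  by apply: eq_card => i; rewrite !inE -leNgt andbC.
have /choice[e1 he1] : forall t : 'I_B, exists e : int,
    P%:Z * `|#|[set i in S | t%:Z < f i x]|%:Z - e * #|S|%:Z| <= #|S|%:Z.
  by move=> t; apply: near (cardC _) _; rewrite or_comm; apply: gS.
have /choice[e2 he2] : forall t : 'I_B, exists e : int,
    P%:Z * `|#|[set i in S | t%:Z < - f i x]|%:Z - e * #|S|%:Z| <= #|S|%:Z.
  move=> t; have -> : [set i in S | t%:Z < - f i x] =
      [set i in S | f i x <= - t%:Z - 1].
    by apply/finset.setP => i; rewrite !inE; congr andb; lia.
  by apply: near (gS x _); rewrite addnC cardC.
exists (\sum_t e1 t - \sum_t e2 t).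
have sumE (g : I -> int) (e : 'I_B -> int) :
    \sum_(i in S) \sum_(t < B) (t%:Z < g i)%R%:Z - (\sum_t e t) * #|S|%:Z =
    \sum_(t < B) (#|[set i in S | t%:Z < g i]|%:Z - e t * #|S|%:Z).
  rewrite exchange_big /= sumrB mulr_suml; congr (_ - _).
  apply: eq_bigr => t _; rewrite -(natz #|_|) -sum1_card natr_sum /=.
  rewrite big_mkcond [RHS]big_mkcond /=.
  by apply: eq_bigr => i _; rewrite !inE; case: (i \in S) => //=; case: ifP.
have -> : \sum_(i in S) f i x - (\sum_t e1 t - \sum_t e2 t) * #|S|%:Z =
    \sum_(t < B) (#|[set i in S | t%:Z < f i x]|%:Z - e1 t * #|S|%:Z) -
    \sum_(t < B) (#|[set i in S | t%:Z < - f i x]|%:Z - e2 t * #|S|%:Z).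
  rewrite -(sumE (f^~ x)) -(sumE (fun i => - f i x)).
  under eq_bigr => i _ do rewrite (int_layer_cake (fB i)).
  by rewrite sumrB; ring.
rewrite (le_trans (ler_wpM2l _ (ler_normB _ _)))// mulrDr.
have bound (g : 'I_B -> int) : (forall t, P%:Z * `|g t| <= #|S|%:Z) ->
    P%:Z * `|\sum_t g t| <= B%:Z * #|S|%:Z.
  move=> hg; rewrite (le_trans (ler_wpM2l _ (ler_norm_sum _ _ _)))// mulr_sumr.
  rewrite (le_trans (ler_sum _ (fun t _ => hg t)))// sumr_const card_ord.
  by rewrite -mulr_natl natz.
by rewrite !PoszM -mulrA (_ : 2%:Z = 1 + 1)// mulrDl mul1r lerD ?bound.
Qed.

(** Expand the square of [p - c / 2]. This caps the one exceptional term of the average in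
    [split_off_limit]. *)
Lemma hdot_sub_le (R : realType) (H : hilbertSpace R) (p c : H) :
  hdot H p (c - p) <= hdot H c c / 4.
Proof.
have := hdot_ge0 (p - 2^-1 *: c).
rewrite hdotBB linearBr /= hdotZl !hdotZr; lra.
Qed.

(** The inner product [t] has [2 * |t| <= 1 + t ^+ 2 <= 1 + D], so [|z| < D + 1], and integrality
    concludes. *)
Lemma hdot_unit_int_le (R : realType) (H : hilbertSpace R) (u c : H) (z : int)
    (D : nat) : `|u| <= 1 -> `|hdot H u c - z%:~R| <= 1 / 8 ->
  hdot H c c <= D%:R -> `|z| <= D%:Z.
Proof.
move=> u1 uz cD; have := le_trans (hdot_unit_sqr_le c u1) cD.
have [t2 t2'] : 2 * hdot H u c <= 1 + hdot H u c ^+ 2 /\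
    - (2 * hdot H u c) <= 1 + hdot H u c ^+ 2.
  have := sqr_ge0 (hdot H u c - 1); have := sqr_ge0 (hdot H u c + 1).
  by rewrite !expr2; lra.
move: uz; rewrite ler_norml => /andP[uz uz'] tD.
suff : (- (D%:Z + 1))%:~R < z%:~R :> R /\ z%:~R < (D%:Z + 1)%:~R :> R.
  by rewrite !ltr_int; lia.
have D0 : 0 <= D%:R :> R by [].
by rewrite rmorphN /= rmorphD /= -pmulrn; split; lra.
Qed.

Lemma hdot_mean_error (R : realType) (H : hilbertSpace R) (I : finType)
    (S : {set I}) (c : I -> H) (u : H) (z : I -> int) (w : int) (P n : nat)
    (E E0 : R) : (0 < #|S|)%N -> (0 < P)%N -> n%:R <= E0 * P%:R ->
  (forall i, `|hdot H u (c i) - (z i)%:~R| <= E) ->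
  P%:Z * `|\sum_(i in S) z i - w * #|S|%:Z| <= (n * #|S|)%:Z ->
  `|hdot H u (mean S c) - w%:~R| <= E + E0.
Proof.
move=> S0 P0 nE uz hw.
have s0 : 0 < #|S|%:R :> R by rewrite ltr0n.
have p0 : 0 < P%:R :> R by rewrite ltr0n.
rewrite hdotZr linear_sumr /=.
rewrite -(ler_pM2r s0) -[X in _ * X]gtr0_norm// -normrM mulrBl mulrAC mulVf ?gt_eqF//.
rewrite mul1r -(subrK (\sum_(i in S) (z i)%:~R) (\sum_(i in S) _)) -sumrB -addrA.
rewrite (le_trans (ler_normD _ _))// mulrDl lerD//.
  rewrite (le_trans (ler_norm_sum _ _ _))// (le_trans (ler_sum _ (fun i _ => uz i)))//.
  by rewrite sumr_const mulr_natr.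
rewrite -(ler_pM2l p0) (@le_trans _ _ (n%:R * #|S|%:R))//.
  move: hw; rewrite -(ler_int R) rmorphM /= intr_norm rmorphB /= rmorphM /=.
  by rewrite rmorph_sum /= -!pmulrn natrM.
by rewrite mulrA ler_wpM2r// mulrC.
Qed.

(* [p] is the mean of a large cut-good subfamily; the average of [<p, c_i - p>]
   over it vanishes, and a single [i] may have [f i = g]. *)
Lemma split_off_limit (R : realType) (H : hilbertSpace R) (X : Type)
    (u : X -> H) (I : finType) (c : I -> H) (f : I -> X -> int) (D P : nat)
    (E E0 : R) (s : int) (x0 : X) :
  (forall x, `|u x| <= 1) -> (0 < P)%N ->
  (forall i x, `|hdot H (u x) (c i) - (f i x)%:~R| <= E) -> E <= 1 / 8 ->
  (2 * D)%:R <= E0 * P%:R -> E0 <= 1 / 8 ->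
  (forall i, hdot H (c i) (c i) <= D%:R) -> injective f ->
  `|s| = 1 -> (forall i, 0 < s * f i x0) ->
  ((2 * D + 2) * P ^ (8 * D).+1 <= #|I|)%N ->
  exists i p (g : X -> int),
    [/\ forall x, `|hdot H (u x) p - (g x)%:~R| <= E + E0,
        g x0 <> 0, g <> f i & - (1 / 8) <= hdot H p (c i - p)].
Proof.
move=> u1 P0 fE E8 DP E08 cD injf s1 sf cardI.
have fE8 i x : `|hdot H (u x) (c i) - (f i x)%:~R| <= 1 / 8 by exact: le_trans E8.
have Q0 : (0 < 2 * D + 2)%N by lia.
have [||| S gS SQ] := cut_good_subset u1 P0 Q0 fE8 cD (k := (8 * D).+1) (n := 0)
  (S := [set: I]%SET).
- by move=> p _; rewrite mul0r hdot_ge0.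
- by lia.
- by rewrite cardsT.
have S0 : (0 < #|S|)%N by lia.
have /choice[g hg] := fun x => cut_good_sum gS
  (fun i => hdot_unit_int_le (u1 x) (fE8 i x) (cD i)).
pose p := mean S c.
(* At [x0] all values have the sign [s], so their sum is at least [#|S|] in absolute value. Were
   [g x0] zero, then [P <= 2 * D], against [16 * D <= P] and [0 < P]. *)
have gx0 : g x0 <> 0.
  move=> g0; have := hg x0; rewrite g0 mul0r subr0.
  have : #|S|%:Z <= `|\sum_(i in S) f i x0|.
    rewrite -[leRHS]mul1r -s1 -normrM mulr_sumr ger0_norm ?sumr_ge0// => [|i _].
      rewrite -natz -sum1_card natr_sum; apply: ler_sum => i _.
      by have := sf i; lia.
    exact: ltW.
  have : (16 * D <= P)%N.
    have : E0 * P%:R <= 1 / 8 * P%:R by rewrite ler_wpM2r.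
    by rewrite -(ler_nat R) natrM; move: DP; rewrite natrM; lra.
  by nia.
have [//|no] := pselect (exists i, g <> f i /\ - (1 / 8) <= hdot H p (c i - p)).
  by move=> [i [gf ip]]; exists i, p, g; split=> // x; exact: hdot_mean_error (hg x).
exfalso.
have small i : g <> f i -> hdot H p (c i - p) <= - (1 / 8).
  by move=> gf; rewrite leNgt; apply/negP => /ltW ip; apply: no; exists i.
have big i : hdot H p (c i - p) <= D%:R / 4.
  rewrite (@le_trans _ _ (hdot H (c i) (c i) / 4))//; last by have := cD i; lra.
  exact: hdot_sub_le.
have [i0 i0S hi0] : exists2 i0, i0 \in S & forall i, i \in S -> i != i0 -> g <> f i.
  have [[i [iS gi]]|ni] := pselect (exists i, i \in S /\ g = f i).
    by exists i => // j _ /eqP ji gj; apply/ji/injf; rewrite -gj.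
  have /card_gt0P[i iS] := S0; exists i => // j jS _ gj; apply: ni; by exists j.
have := sum_hdot_mean c S0; rewrite (big_setD1 i0)//= -/p => sum0.
have : \sum_(i in S :\ i0) hdot H p (c i - p) <= (#|S| - 1)%:R * (- (1 / 8)).
  rewrite (@le_trans _ _ (\sum_(i in S :\ i0) (- (1 / 8))))//.
    by apply: ler_sum => i /setD1P[ii0 iS]; apply/small/hi0.
  by rewrite sumr_const -[leLHS]mulr_natl (cardsD1 i0 S) i0S addKn.
(* The total is at most [D / 4 - (#|S| - 1) / 8], negative because [#|S| >= 2 * D + 2]; this fixes
   the size required of [S]. *)
have := big i0; move: SQ; rewrite -(ler_nat R) natrB// natrD natrM.
have : 0 <= D%:R :> R by [].
lra.
Qed.

(** * Decompositions of a column into pieces *)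

(* Splitting a piece doubles its error and adds that of the new limit; the
   factor [4] per piece absorbs this, up to [1 / 8] for [D + 1] pieces. *)
Definition tol (R : realType) (D k : nat) : R := 4 ^+ k / (8 * 4 ^+ D.+1).

Lemma tol_gt0 (R : realType) (D k : nat) : 0 < tol R D k.
Proof. by rewrite divr_gt0 ?mulr_gt0 ?exprn_gt0. Qed.

Lemma tolS (R : realType) (D k : nat) : tol R D k.+1 = 4 * tol R D k.
Proof. by rewrite /tol exprS mulrA. Qed.

Lemma tol_le (R : realType) (D k l : nat) : (k <= l)%N ->
  tol R D k <= tol R D l.
Proof. by move=> kl; rewrite ler_pM2r ?invr_gt0 ?mulr_gt0 ?exprn_gt0// ler_weXn2l ?ler1n. Qed.

Lemma tol_max (R : realType) (D k : nat) : (k <= D.+1)%N -> tol R D k <= 1 / 8.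
Proof.
move=> /(tol_le R D)/le_trans; apply.
by rewrite /tol invfM mulrCA divff ?mulr1 ?div1r// expf_neq0.
Qed.

(* The vectors [c j] need not sum to the original one: only the identity between
   the integer columns [f j] has to be exact. *)
Definition decomposition (R : realType) (H : hilbertSpace R) (X : Type)
    (u : X -> H) (D : nat) (e : R) (F : X -> int) (k : nat)
    (c : nat -> H) (f : nat -> X -> int) : Prop :=
  [/\ forall x, \sum_(j < k) f j x = F x,
      forall j, (j < k)%N -> exists x, f j x <> 0,
      forall j x, (j < k)%N ->
        `|hdot H (u x) (c j) - (f j x)%:~R| <= tol R D k &
      \sum_(j < k) hdot H (c j) (c j) <= e + k%:R / 4].

(** Only [k + 1] pieces are excluded, because a split adds exactly one piece. *)
Definition max_decomposition (R : realType) (H : hilbertSpace R) (X : Type)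
    (u : X -> H) (D : nat) (e : R) (F : X -> int) (k : nat)
    (c : nat -> H) (f : nat -> X -> int) : Prop :=
  decomposition u D e F k c f /\
  ~ exists c' f', decomposition u D e F k.+1 c' f'.

(** A piece is a nonzero integer at some row, so its vector has inner product at least [7 / 8] in
    absolute value there, and energy at least [3 / 4]. Against the budget [e + k / 4] this gives
    [k <= 2 * e]. *)
Lemma decomposition_size (R : realType) (H : hilbertSpace R) (X : Type)
    (u : X -> H) (D : nat) (e : R) (F : X -> int) (k : nat) c f :
  (forall x, `|u x| <= 1) -> 2 * e <= D%:R -> (k <= D.+1)%N ->
  decomposition u D e F k c f -> (k <= D)%N.
Proof.
move=> u1 eD kD [_ f0 fc ce]; rewrite -(ler_nat R).
have : \sum_(j < k) (3 / 4) <= e + k%:R / 4.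
  apply: le_trans ce; apply: ler_sum => j _.
  have [x fx] := f0 _ (ltn_ord j).
  apply: le_trans (hdot_unit_sqr_le (c j) (u1 x)).
  have : (1 : R) <= `|(f j x)%:~R| by rewrite -intr_norm ler1z; lia.
  have := le_trans (fc _ x (ltn_ord j)) (tol_max R kD).
  set t := hdot H _ _; set z := (f j x)%:~R => tz z1.
  have : 7 / 8 <= `|t|.
    have := ler_normB t (t - z); rewrite opprB addrC subrK; lra.
  rewrite -(real_normK (num_real t)) expr2; nra.
rewrite sumr_const card_ord -mulr_natr; lra.
Qed.

Lemma decomposition_norm (R : realType) (H : hilbertSpace R) (X : Type)
    (u : X -> H) (D : nat) (e : R) (F : X -> int) (k : nat) c f j :
  2 * e <= D%:R -> (k <= D)%N ->
  decomposition u D e F k c f -> (j < k)%N -> hdot H (c j) (c j) <= D%:R.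
Proof.
move=> eD; rewrite -(ler_nat R) => kD [_ _ _ ce] jk.
have := ce; rewrite (bigD1 (Ordinal jk))//=.
have : 0 <= \sum_(i < k | i != Ordinal jk) hdot H (c i) (c i).
  by apply: sumr_ge0 => i _; exact: hdot_ge0.
have : 0 <= D%:R :> R by [].
lra.
Qed.

(** The vectors [p] and [c i - p] replace [c i]. Their energies sum to that of [c i] minus
    [2 * hdot H p (c i - p)], at most [1 / 4] more than before; their errors stay below [2 * tol R D
    k + tol R D 0 <= tol R D k.+1]. *)
Lemma decomposition_split (R : realType) (H : hilbertSpace R) (X : Type)
    (u : X -> H) (D : nat) (e : R) (F : X -> int) (k : nat) c f i
    (p : H) (g : X -> int) (x0 : X) :
  decomposition u D e F k c f -> (i < k)%N ->
  (forall x, `|hdot H (u x) p - (g x)%:~R| <= tol R D k + tol R D 0) ->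
  g x0 <> 0 -> g <> f i -> - (1 / 8) <= hdot H p (c i - p) ->
  exists c' f', decomposition u D e F k.+1 c' f'.
Proof.
move=> [fF f0 fc ce] ik gp gx0 gf pc.
pose upd T (h : nat -> T) a b j := if j == k then a else if j == i then b else h j.
have updk T h (a b : T) : upd T h a b k = a by rewrite /upd eqxx.
have updi T h (a b : T) : upd T h a b i = b.
  by rewrite /upd (ltn_eqF ik) eqxx.
have upd_sum (V : comNzRingType) T (h : nat -> T) a b (phi : T -> V) :
    \sum_(j < k.+1) phi (upd T h a b j) =
    \sum_(j < k) phi (h j) + (phi a + phi b - phi (h i)).
  rewrite big_ord_recr /= updk (bigD1 (Ordinal ik))//= updi.
  rewrite [in RHS](bigD1 (Ordinal ik))//=.
  suff -> : \sum_(j < k | j != Ordinal ik) phi (upd T h a b j) =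
    \sum_(j < k | j != Ordinal ik) phi (h j) by ring.
  apply: eq_bigr => j ji; rewrite /upd (ltn_eqF (ltn_ord j)) ifN//.
have fcS j x : (j < k)%N ->
    `|hdot H (u x) (c j) - (f j x)%:~R| <= tol R D k.+1.
  by move=> jk; rewrite (le_trans (fc _ _ jk))// tol_le.
have t0 : tol R D 0 <= tol R D k by rewrite tol_le.
have tk := tolS R D k; have t00 := tol_gt0 R D 0.
exists (upd _ c p (c i - p)), (upd _ f g (fun x => f i x - g x)); split.
- move=> x; rewrite (upd_sum _ _ _ _ _ (fun h : X -> int => h x)) fF; ring.
- move=> j jk; have [->|jk'] := eqVneq j k; first by exists x0; rewrite updk.
  have [->|ji] := eqVneq j i; last first.
    by rewrite /upd (negbTE jk') (negbTE ji); apply: f0; lia.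
  rewrite updi; apply: contrapT => h; apply: gf; apply/funext => x.
  by apply: contrapT => gx; apply: h; exists x; apply/eqP; rewrite subr_eq0 eq_sym; apply/eqP.
- move=> j x jk; have [->|jk'] := eqVneq j k.
    by rewrite !updk (le_trans (gp x))//; lra.
  have [->|ji] := eqVneq j i; last first.
    by rewrite /upd (negbTE jk') (negbTE ji); apply: fcS; lia.
  rewrite !updi linearBr /= rmorphB /=.
  have := gp x; have := fc _ x ik; rewrite !ler_norml => /andP[? ?] /andP[? ?].
  by apply/andP; split; lra.
rewrite (upd_sum _ _ _ _ _ (fun h => hdot H h h)) hdotBB (hdotC (c i) p).
move: pc; rewrite linearBr /= -[k.+1%:R]natr1; lra.
Qed.

(** Start from the column as a single exact piece. If no decomposition were maximal, the number of
    pieces could be raised to [D + 1], contrary to [decomposition_size]. *)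
Lemma max_decomposition_exists (R : realType) (H : hilbertSpace R) (X : Type)
    (u : X -> H) (D : nat) (e : R) (F : X -> int) (v : H) :
  (forall x, `|u x| <= 1) -> 2 * e <= D%:R -> hdot H v v <= e ->
  (forall x, (F x)%:~R = hdot H (u x) v) ->
  exists k c f, (k <= D)%N /\ max_decomposition u D e F k c f.
Proof.
move=> u1 eD ve Fv.
have [k0 k01 dk0] : exists2 k, (k <= 1)%N & exists c f, decomposition u D e F k c f.
  have [[x Fx]|F0] := pselect (exists x, F x <> 0).
    exists 1%N => //; exists (fun=> v), (fun=> F); split.
    - by move=> y; rewrite big_ord1.
    - by move=> *; exists x.
    - by move=> j y _; rewrite Fv subrr normr0 ltW// tol_gt0.
    - by rewrite big_ord1; lra.
  (* Pieces must be nonzero, so the zero column gets the empty decomposition. *)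
  exists 0%N => //; exists (fun=> v), (fun=> F); split=> //.
  - move=> x; rewrite big_ord0; apply: contrapT => Fx; apply: F0; exists x.
    by move=> h; apply: Fx.
  - by rewrite big_ord0; have := hdot_ge0 v; lra.
apply: contrapT => no.
have dec n : (k0 + n <= D.+1)%N -> exists c f, decomposition u D e F (k0 + n) c f.
  elim: n => [|n IH]; first by rewrite addn0.
  rewrite addnS => kn; have [c [f df]] := IH (ltnW kn).
  apply: contrapT => no'; apply: no; exists (k0 + n)%N, c, f; split => //.
have := dec (D.+1 - k0)%N; rewrite subnKC; last by lia.
move=> /(_ (leqnn _))[c [f df]].
by have := decomposition_size u1 eD (leqnn _) df; rewrite ltnn.
Qed.

(** * Bounding the pieces that meet a row *)

(** The column [F] varies, so pieces of all columns are counted together; [k] is fixed because it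
    sets the tolerance that pieces with a common limit must share. *)
Definition irreducible (R : realType) (H : hilbertSpace R) (X : Type)
    (u : X -> H) (D : nat) (e : R) (k : nat) (h : X -> int) : Prop :=
  exists F c f j, [/\ (k <= D)%N, (j < k)%N,
    max_decomposition u D e F k c f & h = f j].

(** Chosen so that [2 * D = tol R D 0 * cutP D]: the mean then adds an error of at most [tol R D 0]
    to that of the pieces. *)
Definition cutP (D : nat) : nat := 16 * D * 4 ^ D.+1.
Definition maxdeg (D : nat) : nat := (2 * D + 2) * cutP D ^ (8 * D).+1.

(** A family of this size has a limit that splits one of its pieces, raising the number of pieces of
    a maximal decomposition to [k + 1]. *)
Lemma few_irreducible (R : realType) (H : hilbertSpace R) (X : Type)
    (u : X -> H) (D : nat) (e : R) (k : nat) (s : int) (x0 : X)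
    (h : 'I_(maxdeg D) -> X -> int) :
  (0 < D)%N -> (forall x, `|u x| <= 1) -> 2 * e <= D%:R -> `|s| = 1 ->
  (forall i, irreducible u D e k (h i) /\ 0 < s * h i x0) -> ~ injective h.
Proof.
move=> D0 u1 eD s1 hs injh.
have /choice[F /choice[c /choice[f /choice[j hj]]]] := fun i => (hs i).1.
have m0 : (0 < maxdeg D)%N.
  by rewrite muln_gt0 expn_gt0 /cutP !muln_gt0 expn_gt0 D0; lia.
have kD : (k <= D)%N by have [] := hj (Ordinal m0).
have P0 : (0 < cutP D)%N by rewrite /cutP !muln_gt0 expn_gt0 D0.
have [|||||| i [p [g [gp gx gf pc]]]] :=
  @split_off_limit R H X u _ (fun i => c i (j i)) h D (cutP D) (tol R D k)
    (tol R D 0) s x0 u1 P0 _ _ _ _ _ injh s1 (fun i => (hs i).2) _.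
- by move=> i x; have [_ jk [[_ _ + _] _] ->] := hj i; apply.
- by apply: tol_max; lia.
- rewrite /tol expr0 /cutP !natrM natrX.
  have n0 : (4 ^+ D.+1 : R) != 0 by rewrite expf_neq0.
  by rewrite le_eqVlt; apply/orP; left; apply/eqP; field.
- by apply: tol_max.
- by move=> i; have [kD' jk [df _] _] := hj i; exact: decomposition_norm df jk.
- by rewrite card_ord.
have [_ jk [df nd] hf] := hj i; apply: nd.
by apply: decomposition_split df jk gp gx _ pc; rewrite -hf.
Qed.

(** * Coordinates for free actions, translates and indices *)

(** Fix a representative of each orbit; [t x] is the group element carrying it to [x], unique by
    freeness. *)
Lemma free_action_coordinate (G : groupType) (X : Type) (act : G -> X -> X) :
  free_action act -> exists t : X -> G, forall g x, t (act g x) = (g * t x)%g.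
Proof.
move=> [[act1 actM] free].
have /choice[r hr] : forall O : set X, exists z : option X,
    (exists w, O w) -> exists2 w, O w & z = Some w.
  move=> O; have [[w Ow]|no] := pselect (exists w, O w).
    by exists (Some w) => _; exists w.
  by exists None => /no.
pose orb x : set X := range (act ^~ x).
have /choice[t ht] : forall x, exists h w, r (orb x) = Some w /\ act h w = x.
  move=> x; have [|w [g _ gw] rw] := hr (orb x).
    by exists (act 1%g x); exists 1%g.
  by exists g^-1%g, w; split=> //; rewrite -gw -actM mulVg act1.
exists t => g x.
have orbg : orb (act g x) = orb x.
  apply/seteqP; split=> _ [h _ <-].
    by exists (h * g)%g; rewrite //= actM.
  by exists (h * g^-1)%g; rewrite //= -actM mulgVK.
have [w [rw tw]] := ht x; have [w' [rw' tw']] := ht (act g x).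
have ww : w' = w by move: rw'; rewrite orbg rw => -[].
apply: divg1_eq; apply: (free _ (act g x)).
have gx : act (g * t x)%g w = act g x by rewrite actM tw.
by rewrite -[X in act _ X]gx -actM mulgVK -ww.
Qed.

Definition translate (G : groupType) (X : Type) (act : G -> X -> X) (g : G)
  (h : X -> int) : X -> int := fun x => h (act g^-1%g x).

Lemma translateM (G : groupType) (X : Type) (act : G -> X -> X) g g' h :
  is_left_action act -> translate act (g * g')%g h = translate act g (translate act g' h).
Proof. by move=> [_ actM]; apply/funext => x; rewrite /translate invMg actM. Qed.

Lemma translateVK (G : groupType) (X : Type) (act : G -> X -> X) g h :
  is_left_action act -> translate act g^-1%g (translate act g h) = h.
Proof.
by move=> [act1 actM]; apply/funext => x; rewrite /translate invgK -actM mulVg act1.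
Qed.

(** At the largest size [m] for which ['I_m] injects into [A], the injection is onto [A], since a
    missed element would extend it; its inverse is the index. *)
Lemma bounded_set_index (T : Type) (A : set T) (m : nat) :
  (forall h : 'I_m -> T, (forall i, A (h i)) -> ~ injective h) ->
  exists idx : T -> nat, (forall a, A a -> (idx a < m)%N) /\
    (forall a b, A a -> A b -> idx a = idx b -> a = b).
Proof.
elim: m => [no|m IH no].
  have h : 'I_0 -> T by case.
  by exfalso; apply: (no h); case.
have [noinj|/asboolPn] := pselect (forall h : 'I_m -> T, (forall i, A (h i)) -> ~ injective h).
  by have [idx [lt inj]] := IH noinj; exists idx; split=> // a /lt/leqW.
move=> /existsp_asboolPn[h /not_implyP[Ah /contrapT injh]].
have /choice[idx idxP] : forall a, exists i, A a -> exists2 j : 'I_m, i = j :> nat & h j = a.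
  move=> a; have [Aa|nA] := pselect (A a); last by exists 0%N => /nA.
  apply: contrapT => na.
  pose h' (i : 'I_m.+1) := oapp h a (unlift ord_max i).
  apply: (no h') => [i|i j]; rewrite /h'; first by case: unliftP => [i' _|_] /=.
  have ha k : h k <> a by move=> hk; apply: na; exists k; move=> _; exists k.
  case: unliftP => [i' ->|->]; case: unliftP => [j' ->|->] //=.
  - by move=> /injh ->.
  - by move=> /ha.
  - by move=> /esym/ha.
exists idx; split=> [a /idxP[j -> _]|a b /idxP[j ja hj] /idxP[k kb hk]].
  by rewrite ltnS ltnW.
by rewrite ja kb -hj -hk => /ord_inj ->.
Qed.

(** * Equality kernels from pieces *)

(* Freeness of the two actions makes the choices (a decomposition of each
   column, an enumeration of the pieces meeting each row) equivariant: they are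
   made on one point per orbit and transported. *)
Lemma kernel_of_sparse_pieces (G : groupType) (X Y : Type)
    (actX : G -> X -> X) (actY : G -> Y -> Y) (K : X -> Y -> int)
    (piece : nat -> (X -> int) -> Prop) (D m : nat) :
  free_action actX -> free_action actY -> invariant_kernel actX actY K ->
  (forall k g h, piece k h -> piece k (translate actX g h)) ->
  (forall k h, piece k h -> forall x, `|h x| <= D%:Z) ->
  (forall k (s : bool) x (h : 'I_m -> X -> int),
    (forall i, piece k (h i) /\ 0 < (-1) ^+ s * h i x) -> ~ injective h) ->
  (forall y, exists k f, [/\ (k <= D)%N, forall j, (j < k)%N -> piece k (f j) &
    forall x, \sum_(j < k) f j x = K x y]) ->
  exists (sigma : 'I_(D.+1 * D * 2 * D * m) -> int)
      (B : 'I_(D.+1 * D * 2 * D * m) -> X -> Y -> bool),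
    [/\ forall i, sigma i = -1 \/ sigma i = 1,
        forall i, equality_kernel (B i) /\ invariant_kernel actX actY (B i) &
        forall x y, K x y = \sum_i sigma i * (B i x y)%:Z].
Proof.
move=> fX fY Kinv pieceS pieceD pieceX Kpiece.
have [aX aY] : is_left_action actX /\ is_left_action actY by case: fX; case: fY.
have [[X1 XM] [Y1 YM]] := (aX, aY).
have [tX tXM] := free_action_coordinate fX.
have [tY tYM] := free_action_coordinate fY.
pose x0 x := actX (tX x)^-1%g x; pose y0 y := actY (tY y)^-1%g y.
have x0M g x : x0 (actX g x) = x0 x.
  by rewrite /x0 tXM -XM invMg mulgVK.
have y0M g y : y0 (actY g y) = y0 y.
  by rewrite /y0 tYM -YM invMg mulgVK.
have /choice[kk0 /choice[ff0 ff0P]] := Kpiece.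
pose kk y := kk0 (y0 y).
pose ff y j := translate actX (tY y) (ff0 (y0 y) j).
have kkD y : (kk y <= D)%N by have [] := ff0P (y0 y).
have kkM g y : kk (actY g y) = kk y by rewrite /kk y0M.
have ffM g y j : ff (actY g y) j = translate actX g (ff y j).
  by rewrite /ff y0M tYM translateM.
have ffI y j : (j < kk y)%N -> piece (kk y) (ff y j).
  by move=> jk; apply: pieceS; have [_ + _] := ff0P (y0 y); apply.
have ffK x y : \sum_(j < kk y) ff y j x = K x y.
  have [_ _ ->] := ff0P (y0 y); by rewrite Kinv.
have /choice[idx0 idx0P] : forall q : nat * bool * X, exists idx : (X -> int) -> nat,
    (forall h, piece q.1.1 h /\ 0 < (-1) ^+ q.1.2 * h q.2 -> (idx h < m)%N) /\
    (forall h h', piece q.1.1 h /\ 0 < (-1) ^+ q.1.2 * h q.2 ->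
      piece q.1.1 h' /\ 0 < (-1) ^+ q.1.2 * h' q.2 -> idx h = idx h' -> h = h').
  by move=> [[k s] x]; apply: bounded_set_index => h; exact: pieceX.
pose idx k s x h := idx0 (k, s, x0 x) (translate actX (tX x)^-1%g h).
have idxM g k s x h : idx k s (actX g x) (translate actX g h) = idx k s x h.
  by rewrite /idx x0M tXM invMg translateM// translateVK.
have translate0 x h : translate actX (tX x)^-1%g h (x0 x) = h x.
  by rewrite /translate invgK /x0 -XM mulgV X1.
have idx_lt k (s : bool) x h : piece k h -> 0 < (-1) ^+ s * h x -> (idx k s x h < m)%N.
  move=> kh hx; apply: (idx0P (k, s, x0 x)).1; rewrite /= translate0; split=> //.
  exact: pieceS.
have idx_inj k (s : bool) x h h' : piece k h -> 0 < (-1) ^+ s * h x ->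
    piece k h' -> 0 < (-1) ^+ s * h' x -> idx k s x h = idx k s x h' -> h = h'.
  move=> kh hx kh' hx' /(idx0P (k, s, x0 x)).2 hh.
  have : translate actX (tX x)^-1%g h = translate actX (tX x)^-1%g h'.
    by apply: hh; rewrite /= translate0; split=> //; exact: pieceS.
  by move/(congr1 (translate actX (tX x)^-1%g^-1%g)); rewrite !translateVK.
(* One kernel for each piece count [k], piece number [j], sign [s], threshold [t] and index [i]
   among the pieces of that sign at a row. *)
pose T : finType := ('I_D.+1 * 'I_D * bool * 'I_D * 'I_m)%type.
have cT : #|T| = (D.+1 * D * 2 * D * m)%N by rewrite !card_prod !card_ord card_bool.
pose BT (q : T) x y := let: (k, j, s, t, i) := q in
  [&& kk y == k, (j < kk y)%N, (t%:Z < (-1) ^+ s * ff y j x)%R &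
      idx k s x (ff y j) == i].
pose sT (q : T) : int := let: (k, j, s, t, i) := q in (-1) ^+ s.
suff [sP BP KB] : [/\ forall q, sT q = -1 \/ sT q = 1,
    forall q, equality_kernel (BT q) /\ invariant_kernel actX actY (BT q) &
    forall x y, K x y = \sum_q sT q * (BT q x y)%:Z].
  rewrite -cT; exists (sT \o enum_val), (BT \o enum_val); split=> [i|i|x y].
  - exact: sP.
  - exact: BP.
  by rewrite KB (reindex _ (onW_bij _ (@enum_val_bij T))).
split.
- by move=> [[[[k j] []] t] i] /=; [left | right].
- move=> [[[[k j] s] t] i]; split; last first.
    move=> g x y; rewrite /BT kkM ffM idxM; congr [&& _, _, _ < _ & _].
    by rewrite /translate -XM mulVg X1.
  (* Labels are the pieces themselves: [phi x] is the only piece of index [i] passing the threshold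
     at [x], if any, and a column with [k] pieces is labelled by its [j]-th piece. *)
  have /choice[phi phiP] : forall x, exists o : option (X -> int), forall h, piece k h ->
      o = Some h <-> t%:Z < (-1) ^+ s * h x /\ idx k s x h = i.
    move=> x; have [[h [kh [th ih]]]|no] := pselect (exists h, piece k h /\
        t%:Z < (-1) ^+ s * h x /\ idx k s x h = i).
      exists (Some h) => h' kh'; split=> [[<-]//|[th' ih']]; congr Some.
      by apply: (idx_inj k s x) => //; [lia|lia|rewrite ih ih'].
    exists None => h kh; split=> // h'; exfalso; apply: no; exists h; split=> //.
  exists (X -> int), phi,
    (fun y => if (kk y == k) && (j < kk y)%N then Some (ff y j) else None) => x y.
  split=> [/and4P[/eqP kky jk th /eqP ih]|[h []]].
    exists (ff y j); rewrite kky eqxx -kky jk; split=> //.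
    by apply/phiP; rewrite -kky; [exact: ffI|rewrite kky].
  case: ifP => // /andP[/eqP kky jk] /[swap] -[<-].
  have kf : piece k (ff y j) by rewrite -kky; exact: ffI.
  by move=> /(phiP _ _ kf)[th ih]; rewrite /BT kky -kky jk th kky ih !eqxx.
move=> x y; rewrite -ffK.
have sum_i k j s t : \sum_(i < m) sT (k, j, s, t, i) * (BT (k, j, s, t, i) x y)%:Z =
    (-1) ^+ s * [&& kk y == k, (j < kk y)%N & (t%:Z < (-1) ^+ s * ff y j x)%R]%:Z.
  rewrite -mulr_sumr; congr (_ * _).
  case: (boolP [&& _, _ & _]) => [/and3P[/eqP kky jk tf]|no]; last first.
    apply: big1 => i _; rewrite /BT; move: no.
    by case: eqP => //= _; case: ltnP => //= _ /negbTE ->.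
  have lt : (idx k s x (ff y j) < m)%N.
    by apply: idx_lt; [rewrite -kky; exact: ffI | lia].
  rewrite kky in jk; rewrite (bigD1 (Ordinal lt))//= kky !eqxx jk tf big1 ?addr0// => i.
  by rewrite -val_eqE /= eq_sym => /negbTE ->.
have -> : \sum_q sT q * (BT q x y)%:Z =
    \sum_(k < D.+1) \sum_(j < D) \sum_(s : bool) \sum_(t < D) (-1) ^+ s *
      [&& kk y == k, (j < kk y)%N & (t%:Z < (-1) ^+ s * ff y j x)%R]%:Z.
  transitivity (\sum_(k < D.+1) \sum_(j < D) \sum_(s : bool) \sum_(t < D)
      \sum_(i < m) sT (k, j, s, t, i) * (BT (k, j, s, t, i) x y)%:Z).
    by rewrite !pair_bigA /=; apply: eq_bigr => -[[[[k j] s] t] i] _.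
  by do 4![apply: eq_bigr => ? _]; exact: sum_i.
rewrite (bigD1 (Ordinal (kkD y : (kk y < D.+1)%N)))//= [X in _ + X]big1 ?addr0 => [|k kky]; last first.
  do 3![apply: big1 => ? _].
  by rewrite eq_sym -val_eqE /= in kky; rewrite (negbTE kky) mulr0.
rewrite (big_ord_widen D (fun j => ff y j x) (kkD y)) big_mkcond /=.
apply: eq_bigr => j _; rewrite eqxx /=.
case: ifP => jk /=; last by rewrite big1 => // s _; rewrite big1 // => t _; rewrite mulr0.
rewrite big_bool /= -!mulr_sumr expr1 expr0 mul1r mulN1r.
rewrite [LHS](int_layer_cake (pieceD _ _ (ffI _ _ jk) x)) addrC.
by rewrite mul1r mulN1r.
Qed.

(** * Translation of pieces, the count and the conclusion *)

Lemma decomposition_translate (R : realType) (G : groupType) (H : hilbertSpace R)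
    (X : Type) (act : G -> X -> X) (rho : G -> {linear H -> H}) (u : X -> H)
    (D : nat) (e : R) (F : X -> int) (k : nat)
    (c : nat -> H) (f : nat -> X -> int) (g : G) :
  is_left_action act -> orthogonal_representation rho ->
  (forall g x, u (act g x) = rho g (u x)) ->
  decomposition u D e F k c f ->
  decomposition u D e (translate act g F) k (rho g \o c) (translate act g \o f).
Proof.
move=> aX [rho_orth _] urho [fF f0 fc ce].
have [act1 actM] := aX.
have actgV x : act g (act g^-1%g x) = x by rewrite -actM mulgV act1.
split.
- by move=> x; rewrite -[RHS]fF.
- move=> j /f0[x fx]; exists (act g x).
  by rewrite /= /translate -actM mulVg act1.
- move=> j x jk; rewrite /= -{1}(actgV x) urho (rho_orth g).2.
  exact: fc.
- by apply: le_trans ce; apply: ler_sum => j _ /=; rewrite (rho_orth g).2.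
Qed.

Lemma irreducible_translate (R : realType) (G : groupType) (H : hilbertSpace R)
    (X : Type) (act : G -> X -> X) (rho : G -> {linear H -> H}) (u : X -> H)
    (D : nat) (e : R) (k : nat) (g : G) (h : X -> int) :
  is_left_action act -> orthogonal_representation rho ->
  (forall g x, u (act g x) = rho g (u x)) ->
  irreducible u D e k h -> irreducible u D e k (translate act g h).
Proof.
move=> aX rho_rep urho [F [c [f [j [kD jk [df nd] ->]]]]].
exists (translate act g F), (rho g \o c), (translate act g \o f), j.
split=> //; split; first exact: (decomposition_translate g aX rho_rep urho df).
(* A longer decomposition of the translated column moves back by the inverse of [g]. *)
move=> [c' [f' df']]; apply: nd; rewrite -(translateVK g F aX).
by do 2![eexists]; exact: (decomposition_translate g^-1%g aX rho_rep urho df').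
Qed.

Lemma irreducible_le (R : realType) (H : hilbertSpace R) (X : Type)
    (u : X -> H) (D : nat) (e : R) (k : nat) (h : X -> int) (x : X) :
  (forall x, `|u x| <= 1) -> 2 * e <= D%:R -> irreducible u D e k h ->
  `|h x| <= D%:Z.
Proof.
move=> u1 eD [F [c [f [j [kD jk [df _] ->]]]]].
apply: (hdot_unit_int_le (u1 x) _ (decomposition_norm eD kD df jk)).
by have [_ _ /(_ _ x jk)/le_trans + _] := df; apply; apply: tol_max; lia.
Qed.

(** Since [cutP D <= 2 ^ (3 * D + 6) <= 2 ^ (9 * D)], its power is at most [2 ^ (81 * D ^ 2)]; the
    other factors add [4 * D + 2 <= 6 * D ^ 2] to the exponent. *)
Lemma kernel_count_le (D : nat) : (0 < D)%N ->
  (D.+1 * D * 2 * D * maxdeg D <= 2 ^ (87 * D ^ 2))%N.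
Proof.
move=> D0.
have D2 : (D < 2 ^ D)%N by exact: ltn_expl.
have cutPle : (cutP D <= 2 ^ (9 * D))%N.
  apply: (@leq_trans (2 ^ 4 * 2 ^ D * 2 ^ (2 * D.+1)))%N.
    by rewrite /cutP (expnM 2 2) leq_mul// leq_mul// ltnW.
  by rewrite -!expnD leq_exp2l//; lia.
have powle : (cutP D ^ (8 * D).+1 <= 2 ^ (81 * D ^ 2))%N.
  apply: (@leq_trans ((2 ^ (9 * D)) ^ (8 * D).+1))%N; first by rewrite leq_exp2r.
  by rewrite -expnM leq_exp2l// expnS expn1; nia.
apply: (@leq_trans (2 ^ D * 2 ^ D * 2 ^ 1 * 2 ^ D * (2 ^ D.+1 * 2 ^ (81 * D ^ 2))))%N.
  apply: leq_mul; first by do 2![apply: leq_mul => //; try exact: ltnW]; apply: leq_mul => //; exact: ltnW.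
  by apply: leq_mul => //; rewrite expnS; lia.
by rewrite -!expnD leq_exp2l// !expnS expn0; nia.
Qed.

Theorem theorem1p4 (R : realType) :
  exists C : R, 0 < C /\
  forall (G : groupType) (X Y : Type)
    (actX : G -> X -> X) (actY : G -> Y -> Y)
    (gamma : R) (K : X -> Y -> int),
    free_action actX -> free_action actY ->
    finite_set (orbit_space actY) ->
    invariant_kernel actX actY K ->
    equivariant_factorization actX actY gamma (fun x y => (K x y)%:~R) ->
    exists (L : nat) (sigma : 'I_L -> int) (B : 'I_L -> X -> Y -> bool),
      [/\ L%:R <= 2 `^ (C * gamma ^+ 4),
          forall i, sigma i = -1 \/ sigma i = 1,
          forall i, equality_kernel (B i) /\ invariant_kernel actX actY (B i) &
          forall x y, K x y = \sum_(i < L) sigma i * (B i x y)%:Z].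
Proof.
(* [783 = 87 * 9]: the exponent is [87 * D ^ 2], and [D <= 3 * gamma ^+ 2]. *)
exists 783%:R; split; [by rewrite ltr0n | move=> G X Y actX actY gamma K fX fY _ Kinv].
move=> [H [rho [u [v [rho_rep Kuv [u1 vg] urho vrho]]]]].
(* The zero kernel is an empty sum. Otherwise a nonzero integer entry forces [1 <= gamma ^+ 2],
   which absorbs the rounding in [D]. *)
have [[x [y Kxy]]|K0] := pselect (exists x y, K x y <> 0); last first.
  exists 0%N, (fun=> 1), (fun _ _ _ => false); split.
  - exact: powR_ge0.
  - by move=> [].
  - by move=> [].
  - move=> x y; rewrite big_ord0; apply: contrapT => Kxy; apply: K0.
    by exists x, y.
have vgam z : hdot H (v z) (v z) <= gamma ^+ 2.
  by rewrite hdot_norm lerXn2r// ?nnegrE ?(le_trans _ (vg z)).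
have gam1 : 1 <= gamma ^+ 2.
  apply: le_trans (vgam y); apply: le_trans (hdot_unit_sqr_le (v y) (u1 x)).
  by rewrite -Kuv -rmorphXn /= ler1z; nia.
pose D := (Num.trunc (2 * gamma ^+ 2)).+1.
have [Dlo Dhi] : 2 * gamma ^+ 2 <= D%:R /\ D%:R <= 3 * gamma ^+ 2.
  have /truncn_itv/andP[lo hi] : 0 <= 2 * gamma ^+ 2 by lra.
  by split; [exact: ltW | rewrite /D -addn1 natrD; lra].
have D0 : (0 < D)%N by [].
have [||||sigma [B [sP BP KB]]] := @kernel_of_sparse_pieces G X Y actX actY K
  (irreducible u D (gamma ^+ 2)) D (maxdeg D) fX fY Kinv.
- by move=> k g h; apply: irreducible_translate urho => //; case: fX.
- by move=> k h hI z; exact: irreducible_le hI.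
- move=> k s z h hI; apply: few_irreducible hI => //.
  by rewrite normrX normrN1 expr1n.
- move=> z.
  have [k [c [f [kD mf]]]] := max_decomposition_exists u1 Dlo (vgam z) (Kuv ^~ z).
  exists k, f; split=> // [j jk|w]; last by have [[fF _ _ _] _] := mf; rewrite fF.
  by exists (K ^~ z), c, f, j.
exists (D.+1 * D * 2 * D * maxdeg D)%N, sigma, B; split=> //.
apply: (@le_trans _ _ (2 `^ (87 * D ^ 2)%:R)).
  by rewrite powR_mulrn// -natrX ler_nat kernel_count_le.
rewrite ler_powR ?ler1n// natrM natrX.
have : D%:R ^+ 2 <= (3 * gamma ^+ 2) ^+ 2 :> R by rewrite lerXn2r// nnegrE; lra.
by rewrite exprMn -exprM; lra.
Qed.
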